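(* Let $S$ be a nontrivial (that is, $S \neq \mathbb{N}$) pseudosymmetric numerical semigroup with multiplicity $m(S)$ and conductor $c(S)$. (1) If $c(S) \leq m(S)$, then $\dim_{\mathrm{mat}} S = 2$. (2) If $m(S) < c(S) \leq 2m(S)$, then $m(S) - 1 \leq \dim_{\mathrm{mat}} S \leq m(S)$. (3) If $c(S) > 2m(S)$, then $\dim_{\mathrm{mat}} S = m(S)$.
   Context: $\mathbb{N} = \{0,1,2,\ldots\}$. $\mathrm{M}_d(\mathbb{Z})$ and $\mathrm{M}_d(\mathbb{Q})$ denote the sets of $d \times d$ matrices with entries in $\mathbb{Z}$ and $\mathbb{Q}$, respectively. For $A \in \mathrm{M}_d(\mathbb{Q})$, the exponent semigroup of $A$ is $\mathcal{S}(A) = \{ n \in \mathbb{N} : A^n \in \mathrm{M}_d(\mathbb{Z})\}$ (with $A^0 = I$). A numerical semigroup is an additive subsemigroup $S$ of $\mathbb{N}$, containing $0$, with finite complement $\mathbb{N} \setminus S$; it is nontrivial if $S \neq \mathbb{N}$. The multiplicity $m(S)$ is the smallest positive element of $S$ (equivalently, its least minimal generator). The conductor is $c(S) = 1 + \max(\mathbb{N} \setminus S)$. Put $F = c(S) - 1$. $S$ is pseudosymmetric if $F$ is even and, for every $x \in \mathbb{Z} \setminus S$, either $F - x \in S$ or $x = F/2$. The matricial dimension of $S$ is $\dim_{\mathrm{mat}} S = \min\{ d \geq 1 : \text{there is an } A \in \mathrm{M}_d(\mathbb{Q}) \text{ such that } S = \mathcal{S}(A)\}$; it is known that every numerical semigroup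 is an exponent semigroup of some rational matrix, so this minimum exists. *)

(* Defs.v *)
From mathcomp Require Import all_boot all_order all_algebra.
From mathcomp Require Import boolp classical_sets cardinality.

Set Implicit Arguments.
Unset Strict Implicit.
Unset Printing Implicit Defensive.

Import Order.TTheory GRing.Theory Num.Theory.
Local Open Scope classical_set_scope.

(* The default value 0 is returned when A is empty. *)
Definition set_min (A : set nat) : nat :=
  xget 0 [set n | A n /\ forall k, A k -> n <= k].

(* The default value 0 is returned when A is empty or unbounded. *)
Definition set_max (A : set nat) : nat :=
  xget 0 [set n | A n /\ forall k, A k -> k <= n].

Definition numerical_semigroup (S : set nat) : Prop :=
  [/\ S 0, forall a b, S a -> S b -> S (a + b) & finite_set (~` S)].

Definition multiplicity (S : set nat) : nat := set_min [set n | 0 < n /\ S n].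

(* The value on S = setT is not meaningful, since ~` S has no maximum. *)
Definition conductor (S : set nat) : nat := (set_max (~` S)).+1.

(* Here x, and hence F - x, ranges over all the integers, so S is viewed inside
   int through Posz; F./2 is an exact half as F is required to be even. *)
Definition pseudosymmetric (S : set nat) : Prop :=
  let F := (conductor S).-1 in
  ~~ odd F /\
  forall x : int, ~ (Posz @` S) x ->
    (Posz @` S) (Posz F - x)%R \/ x = Posz F./2.

Definition exponent_semigroup (d : nat) (A : 'M[rat]_d) : set nat :=
  [set n | (A ^+ n)%R \is a mxOver Num.int].

(* Since the candidate dimensions are positive, a positive value of matdim S
   means that S is an exponent semigroup of some matrix. *)
Definition matdim (S : set nat) : nat :=
  set_min [set d | 0 < d /\ exists A : 'M[rat]_d, S = exponent_semigroup A].

(* Main.v *)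
(** Lower bound: if some positive power of a rational [d x d] matrix [A] is integral,
    then by Gauss's lemma the minimal polynomial of [A] has integer coefficients,
    so that [A ^+ (n + d)] is an integer combination of the [d] preceding powers.
    Hence [d] consecutive elements of [S] force all later integers into [S],
    and [d] exceeds the length of every run lying below the Frobenius number [F].
    The symmetry [x |-> F - x] maps the gaps [1, ..., m - 1] to the run
    [F - m + 1, ..., F - 1], broken only if [F/2] is one of those gaps, which forces
    [F = 2] or [F = 2 * m - 2].
    Upper bound: with [w i] the least element of [S] congruent to [i] modulo [m],
    the conjugate by [diag(2 ^ w i)] of twice a cyclic permutation matrix of order [m]
    has exponent semigroup [S]: its [n]-th power is integral if and only if
    [w (i + n) <= n + w i] for every [i]. *)
Require Import Defs.
From mathcomp Require Import all_boot all_order all_algebra.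
From mathcomp Require Import boolp classical_sets cardinality.
From mathcomp Require Import zify ring.


Set Implicit Arguments.
Unset Strict Implicit.
Unset Printing Implicit Defensive.

Import Order.TTheory GRing.Theory Num.Theory.
Local Open Scope classical_set_scope.

(** * Integrality of the powers of a rational matrix *)

Section Matrices.
Local Open Scope ring_scope.

Lemma horner_mx_comp_Xn (R : comNzRingType) (d n : nat) (A : 'M[R]_d.+1) (p : {poly R}) :
  horner_mx A (p \Po 'X^n) = horner_mx (A ^+ n) p.
Proof.
elim/poly_ind: p => [|p c IHp]; first by rewrite comp_poly0 !rmorph0.
rewrite comp_polyD comp_polyM comp_polyX comp_polyC !rmorphD !rmorphM /= IHp.
by rewrite rmorphXn /= !horner_mx_X !horner_mx_C.
Qed.

Lemma mxOver_int_map (d : nat) (A : 'M[rat]_d) :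
  A \is a mxOver Num.int -> exists B : 'M[int]_d, A = map_mx intr B.
Proof.
move=> /mxOverP Aint; exists (map_mx Num.floor A).
by apply/matrixP => i j; rewrite !mxE /= floorK.
Qed.

(** Gauss's lemma: [p = a *: p1] where [p1] divides [q] over the integers. Leading coefficients then
    show that [lead_coef p1] divides 1, so [a], its inverse, is an integer. *)
Lemma monic_dvdp_int (p : {poly rat}) (q : {poly int}) :
  p \is monic -> q \is monic -> p %| map_poly intr q ->
  p \is a polyOver Num.int.
Proof.
move=> p_monic q_monic /dvdpP_rat_int [p1 [a a_neq0 p_def] [r q_def]].
have lead_unit : lead_coef p1 \is a GRing.unit.
  have := monicP q_monic; rewrite q_def lead_coefM => lead1.
  by apply/unitrPr; exists (lead_coef r).
have lead_p : a * (lead_coef p1)%:~R = 1.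
  have := monicP p_monic.
  by rewrite p_def lead_coefZ lead_coef_map_inj //; exact: intr_inj.
have a_int : a \is a Num.int.
  suff -> : a = ((lead_coef p1)^-1)%:~R by rewrite intr_int.
  apply: (mulIf (x := (lead_coef p1)%:~R)).
    by apply: contra_eq_neq lead_p => ->; rewrite mulr0 eq_sym oner_neq0.
  by rewrite lead_p -intrM mulVr.
by apply/polyOverP => i; rewrite p_def coefZ coef_map /= rpredM // intr_int.
Qed.

(** By Cayley-Hamilton for the integral matrix [A ^+ n], its characteristic polynomial composed with
    ['X^n] is a monic integer polynomial that annihilates [A]. *)
Lemma mxminpoly_int (d n : nat) (A : 'M[rat]_d.+1) :
  (0 < n)%N -> A ^+ n \is a mxOver Num.int ->
  mxminpoly A \is a polyOver Num.int.
Proof.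
move=> n_gt0 /mxOver_int_map [B An_def].
apply: (@monic_dvdp_int _ (char_poly B \Po 'X^n)); first exact: mxminpoly_monic.
  rewrite monicE lead_coef_comp ?size_polyXn //.
  by rewrite (monicP (char_poly_monic B)) mul1r lead_coefXn expr1n.
rewrite map_comp_poly map_polyXn map_char_poly -An_def.
by apply: mxminpoly_min; rewrite horner_mx_comp_Xn Cayley_Hamilton.
Qed.

Lemma horner_mx_sum (R : comNzRingType) (d : nat) (A : 'M[R]_d.+1) (p : {poly R}) :
  horner_mx A p = \sum_(i < size p) p`_i *: A ^+ i.
Proof.
rewrite -{1}(coefK p) poly_def rmorph_sum; apply: eq_bigr => i _ /=.
by rewrite linearZ /= rmorphXn /= horner_mx_X.
Qed.

Lemma exponent_semigroup_run (d n a : nat) (A : 'M[rat]_d) :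
  (0 < d)%N -> (0 < n)%N -> exponent_semigroup A n ->
  (forall i, (i < d)%N -> exponent_semigroup A (a + i)%N) ->
  forall k, (a <= k)%N -> exponent_semigroup A k.
Proof.
case: d A => // d A _ n_gt0 An_int run.
have p_int := mxminpoly_int n_gt0 An_int.
set p := mxminpoly A in p_int; set D := degree_mxminpoly A.
have leDd : (D <= d.+1)%N.
  have := mxminpoly_dvd_char A => /dvdp_leq.
  rewrite size_char_poly size_mxminpoly; apply.
  exact: monic_neq0 (char_poly_monic A).
have recA : A ^+ D = \sum_(i < D) - p`_i *: A ^+ i.
  have := mx_root_minpoly A; rewrite horner_mx_sum size_mxminpoly big_ord_recr /=.
  have := monicP (mxminpoly_monic A); rewrite lead_coefE size_mxminpoly /= => ->.
  rewrite scale1r addrC => /eqP; rewrite addr_eq0 => /eqP ->.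
  by rewrite -sumrN; apply: eq_bigr => i _; rewrite scaleNr.
elim/ltn_ind => k IHk le_ak.
have [lt_kd | le_dk] := ltnP k (a + d.+1)%N.
  by rewrite -(subnKC le_ak); apply: run; rewrite ltn_subLR.
have leDk : (D <= k)%N by lia.
have leak : (a <= k - D)%N by lia.
rewrite /exponent_semigroup /= -(subnK leDk) exprD recA mulr_sumr.
apply/mxOverP => x y; rewrite summxE rpred_sum // => i _.
rewrite -scalerAr -exprD mxE rpredM ?rpredN ?(polyOverP p_int) //.
apply: (mxOverP (IHk (k - D + i)%N _ _)); last exact: leq_trans leak (leq_addr _ _).
by rewrite -{2}(subnK leDk) ltn_add2l.
Qed.

Lemma int_pow2_div (a b : nat) :
  (2 ^+ a / 2 ^+ b : rat) \is a Num.int = (b <= a)%N.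
Proof.
have [le_ba | lt_ab] := leqP b a.
  by rewrite -expfB_cond ?rpredX ?nat_int // ?implybT.
apply/negbTE/negP => x_int.
have x_gt0 : 0 < (2 ^+ a / 2 ^+ b : rat) by rewrite divr_gt0 ?exprn_gt0.
have := norm_intr_ge1 x_int (lt0r_neq0 x_gt0); rewrite gtr0_norm // leNgt.
by rewrite ltr_pdivrMr ?exprn_gt0 // mul1r ltr_eXn2l // lt_ab.
Qed.

(** * Powers of a weighted cyclic permutation matrix *)

Section WeightedCycle.
Variables (m : nat) (w : nat -> nat).
Hypothesis m_gt0 : (0 < m)%N.

(** The parameter [n] makes this a closed form for the [n]-th power of the weighted cycle, so that
    powers reduce to the addition rule [weighted_cycleD]. *)
Definition weighted_cycle (n : nat) : 'M[rat]_m :=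
  \matrix_(i, j) (if (j : nat) == ((i + n) %% m)%N then 2 ^+ (n + w i)%N / 2 ^+ w j else 0).

Lemma weighted_cycle0 : weighted_cycle 0 = 1%:M.
Proof.
apply/matrixP => i j; rewrite !mxE addn0 modn_small // eq_sym.
rewrite -val_eqE; case: eqP => // /val_inj ->.
by rewrite add0n divff // expf_neq0.
Qed.

Lemma weighted_cycleD (a b : nat) :
  weighted_cycle a *m weighted_cycle b = weighted_cycle (a + b)%N.
Proof.
apply/matrixP => i j; rewrite !mxE.
pose k0 : 'I_m := Ordinal (ltn_pmod (i + a)%N m_gt0).
rewrite (bigD1 k0) //= big1 ?addr0 => [|k]; last first.
  by rewrite -val_eqE /= !mxE => /negbTE ->; rewrite mul0r.
rewrite !mxE /= eqxx modnDml addnA; case: ifP => _; last by rewrite mulr0.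
have nz (e : nat) : (2 ^+ e : rat) != 0 by rewrite expf_neq0.
rewrite mulrA; congr (_ / _).
by rewrite mulrAC -(mulrA (2 ^+ (a + _)%N)) !exprD; field; apply/nz.
Qed.

Lemma weighted_cycleX (n : nat) : weighted_cycle 1 ^+ n = weighted_cycle n.
Proof.
elim: n => [|n IHn]; first by rewrite weighted_cycle0.
by rewrite exprS IHn -[_ * _]/(_ *m _) weighted_cycleD.
Qed.

Lemma exponent_semigroup_weighted_cycle (n : nat) :
  exponent_semigroup (weighted_cycle 1) n <->
  forall i, (i < m)%N -> (w ((i + n) %% m)%N <= n + w i)%N.
Proof.
rewrite /exponent_semigroup /= weighted_cycleX; split => [/mxOverP int_w i lt_im|le_w].
  have := int_w (Ordinal lt_im) (Ordinal (ltn_pmod (i + n)%N m_gt0)).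
  by rewrite mxE /= eqxx int_pow2_div.
apply/mxOverP => i j; rewrite mxE; case: eqP => // ->.
by rewrite int_pow2_div le_w.
Qed.
End WeightedCycle.

(* The matrix [[2, 1/4], [0, 0]] is twice an idempotent, so its powers are
   [[2 ^ n, 2 ^ n / 8], [0, 0]]. *)
Definition quarter_mx : 'M[rat]_2 :=
  \matrix_(i, j) (if i == 0 then if j == 0 then 2 else 4^-1 else 0).

Lemma quarter_mxX (n : nat) :
  quarter_mx ^+ n.+1 = 2 ^+ n *: quarter_mx.
Proof.
elim: n => [|n IHn]; first by rewrite expr0 scale1r.
rewrite exprSr IHn -scalerAl exprSr -scalerA; congr (_ *: _).
apply/matrixP => i j; rewrite -[_ * _]/(_ *m _) !mxE big_ord_recl big_ord1 !mxE /=.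
by case: (i == 0); rewrite ?mul0r ?mulr0 ?addr0.
Qed.

(** The semigroup with gaps 1 and 2 is the only one that occurs when the conductor is at most the
    multiplicity. *)
Lemma exponent_semigroup_quarter_mx (n : nat) :
  exponent_semigroup quarter_mx n <-> (n == 0)%N || (3 <= n)%N.
Proof.
rewrite /exponent_semigroup /=; case: n => [|n] /=.
  by split=> // _; rewrite expr0; apply: mxOver_scalar; rewrite ?rpred0 ?rpred1.
have q_int : (2 ^+ n * 4^-1 : rat) \is a Num.int = (2 <= n)%N.
  by rewrite -[4^-1]/((2 ^+ 2)^-1) int_pow2_div.
rewrite quarter_mxX; split => [/mxOverP/(_ 0 1)|n_ge2].
  by rewrite !mxE /= q_int.
apply/mxOverP => i j; rewrite !mxE; case: (i == 0); last by rewrite mulr0.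
by case: (j == 0); rewrite ?q_int // rpredM ?rpredX.
Qed.
End Matrices.

(** * Extrema of sets of natural numbers *)

Lemma set_minP (A : set nat) :
  (exists n, A n) -> A (set_min A) /\ forall k, A k -> set_min A <= k.
Proof.
move=> A_ex; suff /xgetPex : exists n, A n /\ forall k, A k -> n <= k by apply.
have A_exb : exists n, `[< A n >] by have [n An] := A_ex; exists n; apply/asboolP.
case: (ex_minnP A_exb) => n /asboolP An min_n; exists n; split=> // k Ak.
exact/min_n/asboolP.
Qed.

Lemma set_maxP (A : set nat) :
  finite_set A -> (exists n, A n) -> A (set_max A) /\ forall k, A k -> k <= set_max A.
Proof.
move=> /finite_seqP [s A_def] A_ex.
suff /xgetPex : exists n, A n /\ forall k, A k -> k <= n by apply.
have A_exb : exists n, `[< A n >] by have [n An] := A_ex; exists n; apply/asboolP.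
have A_bnd n : `[< A n >] -> n <= \max_(i <- s) i.
  by move=> /asboolP; rewrite A_def /= => ns; exact: (@leq_bigmax_seq _ s predT id n ns isT).
case: (ex_maxnP A_exb A_bnd) => n /asboolP An max_n; exists n; split=> // k Ak.
exact/max_n/asboolP.
Qed.

(** * Bounds on the matricial dimension of a numerical semigroup *)

Section NumericalSemigroup.
Variable S : set nat.
Hypothesis semiS : numerical_semigroup S.

Lemma conductorP (k : nat) : conductor S <= k -> S k.
Proof.
have [_ _ fin] := semiS; rewrite leqNgt => lt_k; apply: contrapT => nSk.
case/negP: lt_k; rewrite ltnS.
by have [_] := set_maxP fin (ex_intro (~` S) k nSk); apply.
Qed.

Lemma multiplicityP :
  [/\ 0 < multiplicity S, S (multiplicity S) &
      forall k, 0 < k -> S k -> multiplicity S <= k].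
Proof.
have [|[m_gt0 Sm] min_m] := @set_minP [set n | 0 < n /\ S n].
  by exists (conductor S); split=> //; apply: conductorP.
by split=> // k k_gt0 Sk; apply: min_m.
Qed.

Lemma numerical_semigroupMl (m q : nat) : S m -> S (q * m).
Proof.
have [S0 SD _] := semiS => Sm; elim: q => // q IHq.
by rewrite mulSn; apply: SD.
Qed.

Definition apery (m i : nat) : nat := set_min [set s | S s /\ s = i %[mod m]].

Lemma aperyP (m i : nat) : 0 < m ->
  [/\ S (apery m i), apery m i = i %[mod m] &
      forall s, S s -> s = i %[mod m] -> apery m i <= s].
Proof.
move=> m_gt0; have [|[Sw w_mod] min_w] := @set_minP [set s | S s /\ s = i %[mod m]].
  exists (conductor S * m + i); split; last by rewrite modnMDl.
  by apply: conductorP; apply: leq_trans (leq_addr _ _); apply: leq_pmulr.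
by split=> // s Ss s_mod; apply: min_w.
Qed.

(** If [n] is in [S], then [n + apery m i] is an element of [S] in the class of [i + n], hence at
    least the minimum of that class. Conversely row 0 suffices: [apery m 0 = 0], so [n] exceeds an
    element of [S] by a multiple of [m]. *)
Lemma apery_exponent_semigroup (m : nat) :
  0 < m -> S m -> S = exponent_semigroup (@weighted_cycle m (apery m) 1).
Proof.
have [S0 SD _] := semiS => m_gt0 Sm.
apply/seteqP; split=> n.
  move=> Sn; apply/exponent_semigroup_weighted_cycle => // i _.
  have [Swi wi_mod _] := aperyP i m_gt0.
  have [_ _] := aperyP ((i + n) %% m) m_gt0; apply; first exact: SD.
  by rewrite modn_mod addnC -modnDml wi_mod modnDml.
move=> /exponent_semigroup_weighted_cycle -/(_ m_gt0) /(_ 0 m_gt0).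
have [_ _ /(_ 0 S0 erefl)] := aperyP 0 m_gt0; rewrite leqn0 => /eqP ->.
rewrite add0n addn0 => le_wn.
have [Sw w_mod _] := aperyP (n %% m) m_gt0.
have dvd_m : m %| n - apery m (n %% m).
  by rewrite -eqn_mod_dvd // w_mod modn_mod.
rewrite -(subnK le_wn) -(divnK dvd_m); apply: SD => //.
exact: numerical_semigroupMl.
Qed.

Lemma matdim_le (d : nat) (A : 'M[rat]_d) :
  0 < d -> S = exponent_semigroup A -> matdim S <= d.
Proof.
move=> d_gt0 S_def.
have S_ex : [set d | 0 < d /\ exists A : 'M[rat]_d, S = exponent_semigroup A] d.
  by split=> //; exists A.
by have [_] := set_minP (ex_intro _ d S_ex); apply.
Qed.

Lemma matdim_le_multiplicity : matdim S <= multiplicity S.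
Proof.
have [m_gt0 Sm _] := multiplicityP.
exact: matdim_le (apery_exponent_semigroup m_gt0 Sm).
Qed.

Lemma matdim_gt_run (a r g : nat) :
  (forall i, i < r -> S (a + i)) -> a <= g -> ~ S g -> r < matdim S.
Proof.
move=> run le_ag nSg; have [m_gt0 Sm _] := multiplicityP.
have [|[d_gt0 [A S_def]] _] :=
  @set_minP [set d | 0 < d /\ exists A : 'M[rat]_d, S = exponent_semigroup A].
  by exists (multiplicity S); split=> //; eexists; apply: apery_exponent_semigroup.
rewrite ltnNge; apply/negP => le_dr; apply: nSg; rewrite S_def.
apply: (exponent_semigroup_run d_gt0 m_gt0) le_ag; first by rewrite -S_def.
by move=> i lt_id; rewrite -S_def; apply: run; apply: leq_trans le_dr.
Qed.

Lemma Frobenius_gap : S <> [set: nat] -> ~ S (conductor S).-1.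
Proof.
move=> nontriv; have [_ _ fin] := semiS.
have [|] := set_maxP fin; last by [].
apply: contrapT => no_gap; apply: nontriv; apply/seteqP; split=> // k _.
by apply: contrapT => nSk; apply: no_gap; exists k.
Qed.
End NumericalSemigroup.

(** * Reflection of gaps and the three cases *)

Lemma pseudosymmetric_gap (S : set nat) (n : nat) :
  pseudosymmetric S -> ~ S n -> n <= (conductor S).-1 ->
  n.*2 != (conductor S).-1 -> S ((conductor S).-1 - n).
Proof.
move=> [F_even symS] nSn le_nF n_half.
have [|[k Sk [k_def]]|[n_def]] := symS (Posz n).
- by move=> [k Sk [k_def]]; apply: nSn; rewrite -k_def.
- by have -> : (conductor S).-1 - n = k by lia.
by case/eqP: n_half; rewrite n_def even_halfK.
Qed.

Theorem corollary4p3 (S : set nat)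
    (hS : numerical_semigroup S) (hnontrivial : S <> [set: nat])
    (hpseudo : pseudosymmetric S) :
  [/\ conductor S <= multiplicity S -> matdim S = 2,
      multiplicity S < conductor S <= 2 * multiplicity S ->
        multiplicity S - 1 <= matdim S <= multiplicity S &
      2 * multiplicity S < conductor S -> matdim S = multiplicity S].
Proof.
have [S0 _ _] := hS; have [m_gt0 Sm min_m] := multiplicityP hS.
have nSF := Frobenius_gap hS hnontrivial.
have symF n := pseudosymmetric_gap (n := n) hpseudo.
have F_even : ~~ odd (conductor S).-1 by case: hpseudo.
have geF := conductorP hS.
have le_dm := matdim_le_multiplicity hS.
set c := conductor S in nSF symF F_even geF *.
set m := multiplicity S in m_gt0 Sm min_m le_dm *.
have gap n : 0 < n -> n < m -> ~ S n by move=> n_gt0 lt_nm /(min_m _ n_gt0); lia.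
have F_gt0 : 0 < c.-1 by case: (c.-1) nSF.
have F_neqm : c.-1 != m by apply/eqP => F_m; apply: nSF; rewrite F_m.
split=> [le_cm|/andP[lt_mc le_c2m]|lt_2mc].
(* All of [1, ..., F] are gaps here; if [F > 2], then 1 is not [F / 2] and the symmetry would put
   [F - 1] in [S]. *)
- have F2 : c.-1 = 2.
    apply/eqP; rewrite eqn_leq; apply/andP; split; last by lia.
    rewrite leqNgt; apply/negP => F_gt2.
    by apply: (gap (c.-1 - 1)); [lia..|apply: symF; [apply: gap|..]; lia].
  have S_def : S = exponent_semigroup quarter_mx.
    apply/seteqP; split=> n.
      case: n => [|n] Sn; apply/exponent_semigroup_quarter_mx => //=.
      by have := min_m _ (ltn0Sn n) Sn; lia.
    move=> /exponent_semigroup_quarter_mx /orP [/eqP -> //|n_ge3].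
    by apply: geF; lia.
  apply/eqP; rewrite eqn_leq (matdim_le _ S_def) //=.
  (* The run consists of 0 alone. *)
  apply: (@matdim_gt_run S hS 0 1 c.-1) => //.
  by case=> //; rewrite addn0.
- rewrite le_dm andbT.
  (* Otherwise [F <= 2 * m - 4] by parity, and [F / 2 - 1] and [F / 2 + 1] are two gaps below [m]
     exchanged by the symmetry. *)
  have F_eq : c.-1 = 2 * m - 2.
    have [//|F_neq] := eqVneq (c.-1) (2 * m - 2).
    exfalso; apply: (gap (c.-1 - (c.-1)./2.+1)); [lia..|].
    apply: symF; [apply: gap|..]; lia.
  have : m - 2 < matdim S; last by lia.
  (* Now [F / 2 = m - 1], so only the gaps [1, ..., m - 2] reflect, onto the run [m, ..., F - 1]. *)
  apply: (@matdim_gt_run S hS m (m - 2) c.-1) => [i lt_i||//]; last by lia.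
  have -> : m + i = c.-1 - (m - 2 - i) by lia.
  by apply: symF; [apply: gap|..]; lia.
apply/eqP; rewrite eqn_leq le_dm /=.
have : m - 1 < matdim S; last by lia.
(* Here [F / 2 >= m], so each of the gaps [1, ..., m - 1] reflects into [S]. *)
apply: (@matdim_gt_run S hS (c.-1 - (m - 1)) (m - 1) c.-1) => [i lt_i||//].
  have -> : c.-1 - (m - 1) + i = c.-1 - (m - 1 - i) by lia.
  by apply: symF; [apply: gap|..]; lia.
by lia.
Qed.
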